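(* The interleaving distance $d_I$ is a metric on (isomorphism classes of) finitely presented $B_n$-persistence modules.
   Context: Fix a field $k$ and $n\ge 1$. Metrics take values in $[0,\infty]$: a metric on a set $X$ is a function $d:X\times X\to[0,\infty]$ with $d(x,x)=0$, symmetry, the triangle inequality, and $d(x,y)\neq0$ for $x\ne y$. $B_n=k[\mathbb{R}_{\ge0}^n]$ is the monoid ring of $(\mathbb{R}^n_{\ge0},+)$ (spanned by monomials $x_1^{r_1}\cdots x_n^{r_n}$, $r_i\in\mathbb{R}_{\ge 0}$). A $B_n$-persistence module is a $B_n$-module $M$ with a $k$-vector space decomposition $M=\bigoplus_{a\in\mathbb{R}^n}M_a$ such that $x_i^{\alpha}(M_a)\subset M_{a+\alpha \mathbf{e}_i}$ for all $a$, $\alpha\ge0$; morphisms are module homomorphisms $f$ with $f(M_a)\subset N_a$ for all $a$. For $a\le b$ (product order) the transition map $\varphi_M(a,b):M_a\to M_b$ is multiplication by $x_1^{b_1-a_1}\cdots x_n^{b_n-a_n}$. For $v\in\mathbb{R}^n$, $M(v)_a=M_{a+v}$. An $n$-graded set is a set $G$ with a grade function $gr:G\to\mathbb{R}^n$; the free module on it is $\langle G\rangle=\bigoplus_{y\in G}B_n(-gr(y))$. $M$ is finitely presented if $M\cong\langle G\rangle/\langle R\rangle$ for a finite $n$-graded set $G$ and a finite set $R\subset\langle G\rangle$ of homogeneous elements. For $\epsilon\ge0$ let $\vec\epsilon=(\epsilon,\dots,\epsilon)$, $M(\epsilon)=M(\vec\epsilon)$, $f(\epsilon)_a=f_{a+\vec\epsilon}$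 for morphisms $f$, and $S(M,\epsilon):M\to M(\epsilon)$ with $S(M,\epsilon)_a=\varphi_M(a,a+\vec\epsilon)$. $M,N$ are $\epsilon$-interleaved if there are morphisms $f:M\to N(\epsilon)$, $g:N\to M(\epsilon)$ with $g(\epsilon)\circ f=S(M,2\epsilon)$ and $f(\epsilon)\circ g=S(N,2\epsilon)$. $d_I(M,N)=\inf\{\epsilon\ge0: M,N\text{ are }\epsilon\text{-interleaved}\}\in[0,\infty]$. *)

(* Defs.v *)
(* The notations of [monalg] clash with those of MathComp-Analysis, hence the
   import without notations. *)
From HB Require Import structures.
From mathcomp Require Import all_boot all_order all_algebra.
From mathcomp Require Import boolp classical_sets reals constructive_ereal ereal.
From mathcomp Require Import -(notations) finmap monalg.

Set Implicit Arguments.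
Unset Strict Implicit.
Unset Printing Implicit Defensive.

Import Order.TTheory GRing.Theory Num.Theory.
Local Open Scope ring_scope.

Section GeneratedSubmodule.
Context (A : nzRingType) (V : lmodType A) (rs : seq V).

Definition gen_submod : {pred V} := fun x =>
  `[< exists b : 'I_(size rs) -> A, x = \sum_i b i *: rs`_i >].

Lemma gen_submod_closed : submod_closed gen_submod.
Proof.
split.
  by apply/asboolP; exists (fun=> 0); rewrite big1 // => i _; rewrite scale0r.
move=> a x y /asboolP[b ->] /asboolP[c ->]; apply/asboolP.
exists (fun i => a * b i + c i); rewrite scaler_sumr -big_split /=.
by apply: eq_bigr => i _; rewrite scalerDl scalerA.
Qed.
HB.instance Definition _ :=
  GRing.isSubmodClosed.Build A V gen_submod gen_submod_closed.

End GeneratedSubmodule.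

Section QuotientModule.
Context (A : nzRingType) (V : lmodType A) (rs : seq V).
Local Notation S := (gen_submod rs).

Definition quotmod := Quotient.quot S.
HB.instance Definition _ := GRing.Zmodule.on quotmod.

Definition quotmod_pi (x : V) : quotmod := \pi_(Quotient.quot S)%qT x.

Lemma quotmod_piP x y : quotmod_pi x = quotmod_pi y <-> x - y \in S.
Proof. by rewrite Quotient.idealrBE; split=> /eqP. Qed.

Lemma quotmod_piK (q : quotmod) : quotmod_pi (repr q) = q.
Proof. exact: reprK. Qed.

Lemma quotmod_piD x y : quotmod_pi (x + y) = quotmod_pi x + quotmod_pi y.
Proof. exact: (Quotient.pi_add S x y). Qed.

Definition quotmod_scale (a : A) (q : quotmod) : quotmod :=
  quotmod_pi (a *: repr q).

Lemma quotmod_piZ a x : quotmod_pi (a *: x) = quotmod_scale a (quotmod_pi x).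
Proof.
apply/quotmod_piP; rewrite -scalerBr rpredZ //.
by apply/quotmod_piP; rewrite quotmod_piK.
Qed.

Let scaleA a b q :
  quotmod_scale a (quotmod_scale b q) = quotmod_scale (a * b) q.
Proof. by rewrite -[q]quotmod_piK -!quotmod_piZ scalerA. Qed.
Let scale1 : left_id 1 quotmod_scale.
Proof. by move=> q; rewrite -[q]quotmod_piK -!quotmod_piZ scale1r. Qed.
Let scaleDr : right_distributive quotmod_scale +%R.
Proof.
move=> a p q; rewrite -[p]quotmod_piK -[q]quotmod_piK.
by rewrite -quotmod_piD -!quotmod_piZ scalerDr quotmod_piD.
Qed.
Let scaleDl q : {morph quotmod_scale^~ q : a b / a + b}.
Proof.
by move=> a b; rewrite -[q]quotmod_piK -!quotmod_piZ scalerDl quotmod_piD.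
Qed.

HB.instance Definition _ :=
  GRing.Zmodule_isLmodule.Build A quotmod scaleA scale1 scaleDr scaleDl.

Lemma quotmod_pi_is_linear : linear quotmod_pi.
Proof. by move=> a x y; rewrite quotmod_piD quotmod_piZ. Qed.
HB.instance Definition _ :=
  GRing.isLinear.Build A V quotmod *:%R quotmod_pi quotmod_pi_is_linear.

Lemma quotmod_pi_eq0 x : (quotmod_pi x = 0) <-> x \in S.
Proof. by rewrite -(raddf0 quotmod_pi) quotmod_piP subr0. Qed.

End QuotientModule.

Section Exponents.
Context (R : realType) (n : nat).

Definition vle (a b : 'rV[R]_n) : bool := [forall i, a 0 i <= b 0 i].

Lemma vleP (a b : 'rV[R]_n) : reflect (forall i, a 0 i <= b 0 i) (vle a b).
Proof. exact: forallP. Qed.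

Record expo := Expo { expo_val :> 'rV[R]_n; expo_ge0 : vle 0 expo_val }.

HB.instance Definition _ := [isSub for expo_val].
HB.instance Definition _ := [Choice of expo by <:].

Lemma vle00 : vle 0 0.
Proof. exact/vleP. Qed.

Lemma vle0D (a b : 'rV[R]_n) : vle 0 a -> vle 0 b -> vle 0 (a + b).
Proof.
move=> /vleP ha /vleP hb; apply/vleP => i; move: (ha i) (hb i).
by rewrite !mxE; exact: addr_ge0.
Qed.

Definition expo0 : expo := Expo vle00.
Definition expoD (r s : expo) : expo := Expo (vle0D (expo_ge0 r) (expo_ge0 s)).

Lemma expoDA : associative expoD.
Proof. by move=> r s t; apply/val_inj; rewrite /= addrA. Qed.
Lemma expo0D : left_id expo0 expoD.
Proof. by move=> r; apply/val_inj; rewrite /= add0r. Qed.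
Lemma expoD0 : right_id expo0 expoD.
Proof. by move=> r; apply/val_inj; rewrite /= addr0. Qed.
Lemma expoDC : commutative expoD.
Proof. by move=> r s; apply/val_inj; rewrite /= addrC. Qed.
Lemma expoD_eq0 r s : expoD r s = expo0 -> r = expo0 /\ s = expo0.
Proof.
move=> /(congr1 expo_val) /rowP h.
have {}h i : (r : 'rV_n) 0 i = 0 /\ (s : 'rV_n) 0 i = 0.
  have := h i; have := vleP _ _ (expo_ge0 r) i; have := vleP _ _ (expo_ge0 s) i.
  rewrite /= !mxE => s0 r0 /eqP; rewrite paddr_eq0 // => /andP[/eqP-> /eqP->].
  by [].
by split; apply/val_inj/rowP => i; rewrite /= mxE; have [] := h i.
Qed.

HB.instance Definition _ := Choice_isMonomialDef.Build expo
  expoDA expo0D expoD0 expoD_eq0.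
HB.instance Definition _ := MonomialDef_isConomialDef.Build expo expoDC.

Lemma vle0_axis i (t : R) : 0 <= t -> vle 0 (t *: delta_mx 0 i).
Proof.
by move=> t0; apply/vleP => j; rewrite !mxE mulr_ge0 // ler0n.
Qed.

Lemma vle0B (a b : 'rV[R]_n) : vle a b -> vle 0 (b - a).
Proof. by move=> /vleP h; apply/vleP => i; rewrite !mxE subr_ge0. Qed.

Lemma vle0_const (t : R) : 0 <= t -> vle 0 (const_mx t).
Proof. by move=> t0; apply/vleP => i; rewrite !mxE. Qed.

End Exponents.
Arguments expo : clear implicits.
Arguments expo0 {R n}.

(* The monoid ring k[R_{>=0}^n]. *)
Definition Bring (k : fieldType) (R : realType) (n : nat) : comNzRingType :=
  malg (expo R n) k.

Section PersistenceModules.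
Context (k : fieldType) (R : realType) (n : nat).
Local Notation B := (Bring k R n).
Local Notation vec := 'rV[R]_n.
Local Notation malgB := (malg (expo R n) k).

Definition monom (r : expo R n) : B := mkmalgU r (1 : k).

Definition cst (c : k) : B := mkmalgU (expo0 : expo R n) c.

Definition xpow (i : 'I_n) (t : R) (t0 : 0 <= t) : B :=
  monom (Expo (vle0_axis i t0)).

(* [comp a] is M_a: M is the internal direct sum of the k-subspaces M_a, the
   scalars of k acting through [cst], and x_i^t maps M_a to M_(a + t e_i). *)
Record graded (M : lmodType B) (comp : vec -> M -> Prop) : Prop := Graded {
  graded_0 : forall a, comp a 0;
  graded_lin : forall a (c : k) x y,
    comp a x -> comp a y -> comp a (cst c *: x + y);
  graded_span : forall x, exists (s : seq vec) (c : vec -> M),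
    (forall a, comp a (c a)) /\ x = \sum_(a <- s) c a;
  graded_indep : forall (s : seq vec) (c : vec -> M),
    uniq s -> (forall a, comp a (c a)) -> \sum_(a <- s) c a = 0 ->
    forall a, a \in s -> c a = 0;
  graded_act : forall a i (t : R) (t0 : 0 <= t) x,
    comp a x -> comp (a + t *: delta_mx 0 i) (xpow i t0 *: x) }.

Record pmodule := PModule {
  pmod_sort :> lmodType B;
  comp : vec -> pmod_sort -> Prop;
  pmod_graded : graded comp }.

Record hom (M N : pmodule) := Hom {
  hom_fun :> {linear M -> N};
  hom_comp : forall a x, @comp M a x -> @comp N a (hom_fun x) }.

Definition iso (M N : pmodule) : Prop :=
  exists (f : hom M N) (g : hom N M), cancel f g /\ cancel g f.

Lemma hom_id_subproof (M : pmodule) a x :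
  @comp M a x -> @comp M a ((idfun : {linear M -> M}) x).
Proof. by []. Qed.
Definition hom_id (M : pmodule) : hom M M := Hom (@hom_id_subproof M).

Lemma hom_comp_subproof (M N P : pmodule) (g : hom N P) (f : hom M N) a x :
  @comp M a x -> @comp P a ((g \o f : {linear M -> P}) x).
Proof. by move=> hx; apply/hom_comp/hom_comp. Qed.
Definition hom_compose (M N P : pmodule) (g : hom N P) (f : hom M N) :
  hom M P := Hom (@hom_comp_subproof M N P g f).

Section GradedTheory.
Context (M : lmodType B) (comp : vec -> M -> Prop) (gM : graded comp).

Lemma cst1 : cst 1 = 1.
Proof. by []. Qed.

Lemma graded_add a x y : comp a x -> comp a y -> comp a (x + y).
Proof. by move=> hx hy; have := graded_lin gM 1 hx hy; rewrite cst1 scale1r. Qed.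

Lemma graded_scale a c x : comp a x -> comp a (cst c *: x).
Proof. by move=> hx; rewrite -[_ *: _]addr0; apply: graded_lin => //; exact: graded_0. Qed.

Lemma graded_opp a x : comp a x -> comp a (- x).
Proof.
move=> /(graded_scale (-1)); suff -> : cst (-1) = -1 by rewrite scaleN1r.
exact: monalgUN.
Qed.

Lemma mkmalgUM (c d : k) (r s : expo R n) :
  mkmalgU (expoD r s) (c * d) = (mkmalgU r c : B) * (mkmalgU s d : B) :> B.
Proof. by symmetry; exact: fgmulUU. Qed.

Lemma monomD r s : monom (expoD r s) = monom r * monom s.
Proof. by rewrite /monom -mkmalgUM mulr1. Qed.

Lemma cst_monom (c : k) r : mkmalgU r c = cst c * monom r :> B.
Proof. by rewrite /cst /monom -mkmalgUM mulr1 expo0D. Qed.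

Lemma graded_monom a (r : expo R n) x : comp a x -> comp (a + r) (monom r *: x).
Proof.
move=> hx.
have r0 i : 0 <= (r : vec) 0 i.
  by have /vleP /(_ i) := expo_ge0 r; rewrite mxE.
pose e (i : 'I_n) := Expo (vle0_axis i (r0 i)).
pose E (s : seq 'I_n) := foldr (fun i => expoD (e i)) expo0 s.
have hE s : comp (a + E s) (monom (E s) *: x).
  elim: s => [|i s IH] /=; first by rewrite addr0 (_ : monom _ = 1) // scale1r.
  rewrite monomD -scalerA addrCA addrC.
  exact: (graded_act gM).
suff <- : E (index_enum 'I_n) = r by [].
apply/val_inj; rewrite /= [RHS]row_sum_delta.
by rewrite unlock /E; elim: (index_enum _) => //= i s ->.
Qed.

End GradedTheory.

(* M(v) has the same underlying module as M, and M(v)_a = M_(a + v); hence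
   f(v) has the same underlying map as f. *)
Lemma shift_graded (M : pmodule) (v : vec) :
  graded (fun a (x : M) => comp (a + v) x).
Proof.
have gM := pmod_graded M.
have eK : forall a : vec, a - v + v = a by move=> a; rewrite subrK.
have Ke : forall a : vec, a + v - v = a by move=> a; rewrite addrK.
split.
- by move=> a; exact: graded_0.
- by move=> a; exact: graded_lin.
- move=> x; have [s [c [hc ->]]] := graded_span gM x.
  exists [seq a - v | a <- s], (fun a => c (a + v)); split=> //.
  by rewrite big_map; apply: eq_bigr => a _; rewrite eK.
- move=> s c us hc h0 a sa; rewrite -(Ke a).
  apply: (@graded_indep _ _ gM [seq a + v | a <- s] (fun a => c (a - v))).
  + by rewrite map_inj_uniq //; exact: addIr.
  + by move=> b; rewrite -{1}(eK b).
  + by rewrite big_map -[RHS]h0; apply: eq_bigr => b _; rewrite Ke.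
  + exact: map_f.
- by move=> a i t t0 x hx; rewrite addrAC; exact: graded_act.
Qed.

Definition shift (M : pmodule) (v : vec) : pmodule := PModule (shift_graded M v).

Lemma shift_hom_subproof (M N : pmodule) (v : vec) (f : hom M N) a x :
  @comp (shift M v) a x ->
  @comp (shift N v) a ((hom_fun f : {linear shift M v -> shift N v}) x).
Proof. exact: (@hom_comp _ _ f (a + v) x). Qed.
Definition shift_hom (M N : pmodule) (v : vec) (f : hom M N) :
  hom (shift M v) (shift N v) := Hom (@shift_hom_subproof M N v f).

(* phi_M(a,b), as the restriction to [comp a] of an endomap of [M]. *)
Definition transition (M : pmodule) (a b : vec) (ab : vle a b) (x : M) : M :=
  monom (Expo (vle0B ab)) *: x.

Lemma transition_comp (M : pmodule) (a b : vec) (ab : vle a b) (x : M) :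
  comp a x -> comp b (transition ab x).
Proof.
move=> /(graded_monom (pmod_graded M) (Expo (vle0B ab))).
by rewrite /= addrC subrK.
Qed.

Lemma scale_linear (M : lmodType B) (m b : B) (x y : M) :
  m *: (b *: x + y) = b *: (m *: x) + m *: y.
Proof. by rewrite scalerDr !scalerA (mulrC m b). Qed.

Section Smap.
Context (M : pmodule) (e : R) (e0 : 0 <= e).

(* On each M_a this is the transition map M_a -> M_(a + e): see [SmapE]. *)
Definition Smap_fun (x : M) : shift M (const_mx e) :=
  monom (Expo (vle0_const n e0)) *: x.

Lemma Smap_is_linear : linear Smap_fun.
Proof. by move=> b x y; exact: scale_linear. Qed.
HB.instance Definition _ :=
  GRing.isLinear.Build B M (shift M (const_mx e)) *:%R Smap_fun Smap_is_linear.

Lemma Smap_subproof a x :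
  @comp M a x ->
  @comp (shift M (const_mx e)) a
    ((Smap_fun : {linear M -> shift M (const_mx e)}) x).
Proof.
exact: (@graded_monom M _ (pmod_graded M) a (Expo (vle0_const n e0)) x).
Qed.

Definition Smap : hom M (shift M (const_mx e)) := Hom Smap_subproof.

Lemma SmapE a (h : vle a (a + const_mx e)) (x : M) :
  comp a x -> Smap x = transition h x.
Proof.
move=> _; have E : Expo (vle0B h) = Expo (vle0_const n e0).
  by apply/val_inj; rewrite /= addrAC subrr add0r.
by rewrite /transition E.
Qed.

End Smap.

Lemma double_ge0 (e : R) : 0 <= e -> 0 <= 2 * e.
Proof. by move=> e0; rewrite mulr_ge0. Qed.

(* M(e)(e) and M(2e) have the same underlying module [M], and the same
   grading up to (a + e) + e = a + 2e; the equations are read in [M], [N]. *)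
Definition interleaved (e : R) (e0 : 0 <= e) (M N : pmodule) : Prop :=
  exists (f : hom M (shift N (const_mx e))) (g : hom N (shift M (const_mx e))),
    (forall x : M, hom_compose (shift_hom (const_mx e) g) f x
                   = Smap M (double_ge0 e0) x :> M) /\
    (forall y : N, hom_compose (shift_hom (const_mx e) f) g y
                   = Smap N (double_ge0 e0) y :> N).

Definition dI (M N : pmodule) : \bar R :=
  ereal_inf [set x | exists (e : R) (e0 : 0 <= e),
                       interleaved e0 M N /\ x = e%:E]%classic.

(* A family of additive projections onto the components gives a
   direct sum decomposition. *)
Lemma graded_proj (M : lmodType B) (comp : vec -> M -> Prop)
    (p : vec -> M -> M) :
  (forall a, comp a 0) ->
  (forall a c x y, comp a x -> comp a y -> comp a (cst c *: x + y)) ->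
  (forall a x y, p a (x + y) = p a x + p a y) ->
  (forall a x, comp a (p a x)) ->
  (forall a b x, comp a x -> p b x = if a == b then x else 0) ->
  (forall x, exists s : seq vec, x = \sum_(a <- s) p a x) ->
  (forall a i (t : R) (t0 : 0 <= t) x,
    comp a x -> comp (a + t *: delta_mx 0 i) (xpow i t0 *: x)) ->
  graded comp.
Proof.
move=> c0 cl pD pc pE ps ca; split=> //.
- by move=> x; have [s hs] := ps x; exists s, (p^~ x).
- move=> s c us hc h0 a sa.
  have p0 b : p b 0 = 0 by rewrite (pE b) //; case: ifP.
  have : p a (\sum_(a <- s) c a) = 0 by rewrite h0.
  rewrite (big_morph (p a) (pD a) (p0 a)) (bigD1_seq a) //= (pE a) // eqxx.
  by rewrite big1 ?addr0 // => b /negPf ba; rewrite (pE b) // ba.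
Qed.

(* B_a is spanned by x^a if a >= 0, and is 0 otherwise. *)
Definition Bcomp (a : vec) (p : malgB) : Prop :=
  forall r : expo R n, mcoeff r p != 0 -> expo_val r = a.

Lemma Bproj_sig : {f : vec -> malgB -> malgB |
  forall a p r, mcoeff r (f a p) = if expo_val r == a then mcoeff r p else 0}.
Proof.
exists (fun a p => if insub a is Some r then mkmalgU r (mcoeff r p) else 0).
move=> a p r; case: insubP => [u ha ua|ha].
  rewrite mcoeffU -ua val_eqE eq_sym.
  by case: eqVneq => [->|_]; rewrite ?mulr1n ?mulr0n.
rewrite mcoeff0; case: eqP => // ra; by rewrite -ra (expo_ge0 r) in ha.
Qed.

Definition Bproj : vec -> malgB -> malgB := sval Bproj_sig.

Lemma BprojE a (p : malgB) (r : expo R n) :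
  mcoeff r (Bproj a p) = if expo_val r == a then mcoeff r p else 0.
Proof. exact: (svalP Bproj_sig). Qed.

Lemma malg_ext (p q : malgB) :
  (forall r : expo R n, mcoeff r p = mcoeff r q) -> p = q.
Proof. by move=> h; apply/(malgP p q). Qed.

Lemma Bcoeff_scale (c : k) (p : malgB) r :
  mcoeff r (cst c * p) = c * mcoeff r p.
Proof. exact: mcoeffCM. Qed.

Lemma BprojD a (p q : malgB) : Bproj a (p + q) = Bproj a p + Bproj a q.
Proof.
apply: malg_ext => r; rewrite [LHS]BprojE [RHS]mcoeffD 2!BprojE [mcoeff r (p + q)]mcoeffD.
by case: ifP => //; rewrite addr0.
Qed.

Lemma Bproj_comp a (p : malgB) : Bcomp a (Bproj a p).
Proof. by move=> r; rewrite BprojE; case: ifP => [/eqP//|_ /eqP]. Qed.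

Lemma Bproj_id a b (p : malgB) : Bcomp a p -> Bproj b p = if a == b then p else 0.
Proof.
move=> hp; apply: malg_ext => r; rewrite BprojE (fun_if (mcoeff r)) mcoeff0.
have [r0|/hp ->//] := eqVneq (mcoeff r p) 0.
by rewrite r0 !if_same.
Qed.

Lemma Bproj_sum (p : malgB) (s : seq vec) : uniq s ->
  {subset [seq expo_val r | r <- msupp p] <= s} ->
  p = \sum_(a <- s) Bproj a p.
Proof.
move=> us hs; apply: malg_ext => r.
rewrite (big_morph (mcoeff r) (mcoeffD r) (mcoeff0 r)).
under eq_bigr do rewrite BprojE.
case: (boolP (expo_val r \in s)) => [rs|].
  rewrite (bigD1_seq _ rs us) /= eqxx big1 ?addr0 // => b.
  by rewrite eq_sym => /negPf ->.
move=> rs; rewrite big_seq big1; last first.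
  by move=> b bs; case: eqP => // rb; rewrite rb bs in rs.
apply: mcoeff_outdom; apply: contra rs => hr; apply: hs.
exact: map_f.
Qed.

Lemma Bcomp_lin a c (x y : malgB) : Bcomp a x -> Bcomp a y -> Bcomp a (cst c * x + y).
Proof.
move=> hx hy r; rewrite mcoeffD Bcoeff_scale => h.
have [y0|] := eqVneq (mcoeff r y) 0; last exact: hy.
by apply: hx; apply: contra_neq h => x0; rewrite x0 y0 mulr0 addr0.
Qed.

Lemma Bcomp_act a (s : expo R n) (x : malgB) : Bcomp a x -> Bcomp (a + s) (monom s * x).
Proof.
move=> hx r; rewrite mcoeff_neq0 => /msuppM_le[u [v [hu hv ->]]].
move: hu; rewrite msuppU1 => /fset1P ->.
by rewrite /= addrC hx // mcoeff_neq0.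
Qed.

Lemma Bgraded : @graded B^o Bcomp.
Proof.
apply: (@graded_proj B^o Bcomp Bproj).
- by move=> a r; rewrite mcoeff0 eqxx.
- exact: Bcomp_lin.
- exact: BprojD.
- exact: Bproj_comp.
- by move=> *; exact: Bproj_id.
- move=> x; exists (undup [seq expo_val r | r <- msupp (x : malgB)]).
  by apply: Bproj_sum; [exact: undup_uniq|move=> a; rewrite mem_undup].
- by move=> a i t t0 x; exact: Bcomp_act.
Qed.

Definition Bmod : pmodule := PModule Bgraded.

Section Free.
Context (G : finType) (gr : G -> vec).

(* The direct sum of the B(- gr y), y in G, graded componentwise; only finite G
   are needed, for which the underlying module is {ffun G -> B^o}. *)
Definition free_comp (a : vec) (p : {ffun G -> B^o}) : Prop :=
  forall y, @comp (shift Bmod (- gr y)) a (p y).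

Definition free_proj (a : vec) (p : {ffun G -> B^o}) : {ffun G -> B^o} :=
  [ffun y => Bproj (a - gr y) (p y) : B^o].

Lemma free_graded : @graded {ffun G -> B^o} free_comp.
Proof.
apply: (@graded_proj {ffun G -> B^o} free_comp free_proj).
- by move=> a y; rewrite ffunE; exact: (graded_0 Bgraded).
- move=> a c x y hx hy z; rewrite !ffunE.
  exact: (graded_lin (pmod_graded (shift Bmod _))).
- by move=> a x y; apply/ffunP => z; rewrite !ffunE BprojD.
- by move=> a x y; rewrite ffunE; exact: Bproj_comp.
- move=> a b x hx; apply/ffunP => y; rewrite ffunE (Bproj_id _ (hx y)).
  by rewrite (inj_eq (addIr _)); case: ifP => // _; rewrite ffunE.
- move=> x.
  pose S y := [seq expo_val r + gr y | r <- msupp (x y : malgB)].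
  pose T := undup (flatten [seq S y | y <- enum G]).
  exists T; apply/ffunP => y; rewrite sum_ffunE.
  under eq_bigr do rewrite ffunE.
  rewrite -(big_map (fun a => a - gr y) xpredT (fun a => Bproj a (x y))).
  apply: Bproj_sum; first by rewrite map_inj_uniq ?undup_uniq //; exact: addIr.
  move=> _ /mapP[r hr ->]; apply/mapP; exists (expo_val r + gr y); last first.
    by rewrite addrK.
  rewrite mem_undup; apply/flattenP; exists (S y).
    by apply: map_f; rewrite mem_enum.
  exact: map_f.
- move=> a i t t0 x hx y; rewrite ffunE.
  exact: (graded_act (pmod_graded (shift Bmod _))).
Qed.

Definition free : pmodule := PModule free_graded.

End Free.

Definition homogeneous (M : pmodule) (x : M) : Prop := exists a, comp a x.

Section Quot.
Context (M : pmodule) (rs : seq M) (hrs : forall r, r \in rs -> homogeneous r).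

Local Notation Q := (quotmod rs).
Local Notation proj := (@quotmod_pi _ M rs).

Definition quot_comp (a : vec) (q : Q) : Prop :=
  exists x : M, comp a x /\ q = proj x.

(* Every element of the submodule is a finite sum of homogeneous elements
   of the submodule. *)
Let hdec (z : M) : Prop := exists (s : seq vec) (c : vec -> M),
  [/\ uniq s, forall a, comp a (c a), forall a, c a \in gen_submod rs,
      forall a, a \notin s -> c a = 0 & z = \sum_(a <- s) c a].

Let hdec0 : hdec 0.
Proof.
exists [::], (fun=> 0); split=> //; rewrite ?big_nil //.
- by move=> a; exact: (graded_0 (pmod_graded M)).
- by move=> a; exact: rpred0.
Qed.

Let sum_ext (s t : seq vec) (c : vec -> M) : uniq s -> uniq t ->
  {subset s <= t} -> (forall a, a \notin s -> c a = 0) ->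
  \sum_(a <- s) c a = \sum_(a <- t) c a.
Proof.
move=> us ut st c0.
rewrite [RHS](bigID [in s]) /= [X in _ + X]big1 ?addr0 => [|a]; last exact: c0.
rewrite -[RHS]big_filter; apply: perm_big; apply: uniq_perm => //.
  exact: filter_uniq.
by move=> a; rewrite mem_filter; case: (boolP (a \in s)) => // /st ->.
Qed.

Let hdecD x y : hdec x -> hdec y -> hdec (x + y).
Proof.
move=> [s [c [us hc Sc c0 ->]]] [t [d [ut hd Sd d0 ->]]].
pose w := undup (s ++ t).
have uw : uniq w by exact: undup_uniq.
have sw : {subset s <= w} by move=> a; rewrite mem_undup mem_cat => ->.
have tw : {subset t <= w} by move=> a; rewrite mem_undup mem_cat orbC => ->.
exists w, (fun a => c a + d a); split=> //.
- by move=> a; exact: (graded_add (pmod_graded M)).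
- by move=> a; exact: rpredD.
- move=> a aw; rewrite c0 ?d0 ?addr0 //.
    by apply: contra aw => /tw.
  by apply: contra aw => /sw.
- by rewrite (sum_ext us uw) // (sum_ext ut uw) // big_split.
Qed.

Let hdec1 a (x : M) : comp a x -> x \in gen_submod rs -> hdec x.
Proof.
move=> hx Sx; exists [:: a], (fun b => if b == a then x else 0); split=> //.
- move=> b; case: eqP => [->//|_]; exact: (graded_0 (pmod_graded M)).
- by move=> b; case: ifP => // _; exact: rpred0.
- by move=> b; rewrite inE => /negPf ->.
- by rewrite big_seq1 eqxx.
Qed.

Let hdec_sum (I : Type) (s : seq I) (F : I -> M) :
  (forall i, hdec (F i)) -> hdec (\sum_(i <- s) F i).
Proof. by move=> h; apply: big_ind. Qed.

Let gen_hdec z : z \in gen_submod rs -> hdec z.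
Proof.
move=> /asboolP[b ->]; apply: hdec_sum => i.
have [a ha] : homogeneous rs`_i by apply: hrs; exact: mem_nth.
have Si : rs`_i \in gen_submod rs.
  apply/asboolP; exists (fun j => (j == i)%:R).
  rewrite (bigD1 i) //= eqxx scale1r big1 ?addr0 // => j /negPf ->.
  by rewrite scale0r.
rewrite [b i](monalgE (b i : malgB)) scaler_suml.
apply: hdec_sum => r; rewrite cst_monom -scalerA.
apply: (hdec1 (a := a + r)); last by do 2!apply: rpredZ.
apply: (graded_scale (pmod_graded M)).
exact: (graded_monom (pmod_graded M)).
Qed.

Lemma quot_graded : graded quot_comp.
Proof.
have gM := pmod_graded M; split.
- by move=> a; exists 0; split; [exact: graded_0|rewrite raddf0].
- move=> a c _ _ [x [hx ->]] [y [hy ->]]; exists (cst c *: x + y).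
  by split; [exact: graded_lin|rewrite linearP].
- move=> q; rewrite -[q]quotmod_piK.
  have [s [c [hc ->]]] := graded_span gM (repr q).
  exists s, (fun a => proj (c a)); split; last by rewrite raddf_sum.
  by move=> a; exists (c a).
- move=> s c us hc h0 a sa.
  have [d hd] := choice hc.
  have {}h0 : \sum_(a <- s) d a \in gen_submod rs.
    apply/quotmod_pi_eq0; rewrite raddf_sum -[RHS]h0.
    by apply: eq_bigr => b _; case: (hd b) => _ ->.
  have [t [z [ut hz Sz z0 e]]] := gen_hdec h0.
  pose w := undup (s ++ t).
  have uw : uniq w by exact: undup_uniq.
  pose d' b := if b \in s then d b else 0.
  have e' : \sum_(b <- w) (d' b - z b) = 0.
    rewrite sumrB; apply/eqP; rewrite subr_eq0; apply/eqP.
    rewrite -(sum_ext us uw); last by move=> b /negPf; rewrite /d' => ->.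
      rewrite -(sum_ext ut uw) //; last first.
        by move=> b; rewrite mem_undup mem_cat orbC => ->.
      by rewrite -e big_seq [RHS]big_seq; apply: eq_bigr => b; rewrite /d' => ->.
    by move=> b; rewrite mem_undup mem_cat => ->.
  have /eqP : d' a - z a = 0.
    apply: (graded_indep gM uw _ e'); last by rewrite mem_undup mem_cat sa.
    move=> b; apply: (graded_add gM); last exact: (graded_opp gM).
    by rewrite /d'; case: ifP => _; [case: (hd b)|exact: graded_0].
  rewrite /d' sa subr_eq0 => /eqP da.
  by case: (hd a) => _ ->; apply/quotmod_pi_eq0; rewrite da.
- move=> a i t t0 _ [x [hx ->]]; exists (xpow i t0 *: x).
  by split; [exact: graded_act|rewrite linearZ].
Qed.

Definition pquot : pmodule := PModule quot_graded.

End Quot.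

Definition finitely_presented (M : pmodule) : Prop :=
  exists (G : finType) (gr : G -> vec) (rs : seq (free gr))
         (hrs : forall r, r \in rs -> homogeneous r),
    iso M (pquot hrs).

Record fpmodule := FPModule {
  fp_mod :> pmodule;
  fp_modP : finitely_presented fp_mod }.

Lemma iso_refl (M : pmodule) : iso M M.
Proof. by exists (hom_id M), (hom_id M). Qed.

Lemma iso_sym (M N : pmodule) : iso M N -> iso N M.
Proof. by move=> [f [g [fK gK]]]; exists g, f. Qed.

Lemma iso_trans (M N P : pmodule) : iso M N -> iso N P -> iso M P.
Proof.
move=> [f [g [fK gK]]] [f' [g' [fK' gK']]].
exists (hom_compose f' f), (hom_compose g g').
by split=> x; rewrite /= ?fK' ?gK ?fK ?gK'.
Qed.

Definition iso_to (M : fpmodule) : fpmodule -> Prop := fun N => iso M N.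

Record iso_class := IsoClass {
  iso_class_pred :> fpmodule -> Prop;
  iso_classP : exists M, iso_class_pred = iso_to M }.

Definition class_of (M : fpmodule) : iso_class :=
  @IsoClass (iso_to M) (ex_intro _ M erefl).

Lemma class_of_eq (M N : fpmodule) : class_of M = class_of N <-> iso M N.
Proof.
split=> [/(congr1 iso_class_pred) /= h|h].
  by have : iso_to M N by rewrite h; exact: iso_refl.
have e : iso_to M = iso_to N.
  apply: functional_extensionality_dep => P; apply/propext.
  by split=> hP; [apply: iso_trans hP; exact: iso_sym|exact: iso_trans hP].
rewrite /class_of; move: (ex_intro _ M _) (ex_intro _ N _) => /= p q.
by move: p q; rewrite e => p q; congr IsoClass; exact: Prop_irrelevance.
Qed.

Lemma class_of_surj (C : iso_class) : exists M, C = class_of M.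
Proof.
case: C => p [M e]; exists M; subst p; rewrite /class_of; congr IsoClass.
Qed.

End PersistenceModules.

Arguments pmodule : clear implicits.
Arguments fpmodule : clear implicits.
Arguments iso_class : clear implicits.

Record is_metric (R : realType) (X : Type) (d : X -> X -> \bar R) : Prop :=
  IsMetric {
    metric_ge0 : forall x y, (0 <= d x y)%E;
    metric_refl : forall x, d x x = 0%E;
    metric_sym : forall x y, d x y = d y x;
    metric_triangle : forall x y z, (d x z <= d x y + d y z)%E;
    metric_sep : forall x y, x <> y -> d x y <> 0%E }.

(* Main.v *)
(** Only separation is not formal.  Let [dI M N = 0] with [M], [N] finitely
    presented, and let [e] be so small that no two coordinates [s], [t] of
    grades of generators or relations of [M] and [N] satisfy
    [t < s <= t + 2 e].  Then for every grade [z] of a generator or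
    relation, multiplication by [x^e] is a bijection from [N_z] to [N_(z + e)].
    Hence the images of the generators of [M] under an [e]-interleaving map [f]
    can be divided by [x^e], which yields a morphism [f' : M -> N] with
    [x^e f' = f]; likewise [g = x^e g'].  From [g f = x^(2 e)] and injectivity
    of [x^(2 e)] on the grades of the generators, [g' f' = id]. *)
From HB Require Import structures.
From mathcomp Require Import all_boot all_order all_algebra.
From mathcomp Require Import boolp classical_sets reals constructive_ereal ereal.
From mathcomp Require Import -(notations) finmap monalg.
From mathcomp Require Import lra.
Require Import Defs.

Set Implicit Arguments.
Unset Strict Implicit.
Unset Printing Implicit Defensive.

Import Order.TTheory GRing.Theory Num.Theory.
Local Open Scope ring_scope.

Section Interleaving.
Context (k : fieldType) (R : realType) (n : nat).
Local Notation B := (Bring k R n).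
Local Notation vec := 'rV[R]_n.
Local Notation pmod := (pmodule k R n).

(** * Interleavings as degree-raising linear maps *)

Definition diag_monom (e : R) (e0 : 0 <= e) : B :=
  monom k (Expo (vle0_const n e0)).

(* [rewrite scalerA] makes [Bring] unfold, and diverges, unless the scalars are
   variables. *)
Lemma scale_scale (V : lmodType B) (a b c : B) (x : V) :
  c = a * b -> a *: (b *: x) = c *: x.
Proof. by move=> ->; rewrite scalerA. Qed.

Lemma scale_sumr (V : lmodType B) (I : finType) (m : B) (b c : I -> B)
    (v : I -> V) :
  (forall i, b i = m * c i) -> \sum_i b i *: v i = m *: \sum_i c i *: v i.
Proof.
by move=> h; rewrite scaler_sumr; apply: eq_bigr => i _; rewrite h scalerA.
Qed.

(** Applied to an interleaving whose two legs have both been divided by [m]: linearity of [f2] takes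
    one factor out, and [h2] supplies the other. *)
Lemma scale_composite (M N P : lmodType B) (m m2 : B)
    (f1 h1 : {linear M -> N}) (f2 h2 : {linear N -> P}) :
  m2 = m * m -> (forall x, m *: h1 x = f1 x) -> (forall y, m *: h2 y = f2 y) ->
  forall x, m2 *: h2 (h1 x) = f2 (f1 x).
Proof. by move=> -> E1 E2 x; rewrite -E1 linearZ /= -E2 scalerA. Qed.

Lemma monom_eq (r s t : expo R n) : (r : vec) = (s : vec) + (t : vec) ->
  monom k r = monom k s * monom k t.
Proof. by move=> h; rewrite -monomD; congr monom; apply/val_inj. Qed.

Lemma diag_monomD (e1 e2 e : R) (h1 : 0 <= e1) (h2 : 0 <= e2) (h : 0 <= e) :
  e = e1 + e2 -> diag_monom h = diag_monom h1 * diag_monom h2.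
Proof. by move=> E; apply: monom_eq; apply/rowP => i; rewrite /= E !mxE. Qed.

Lemma diag_monom0 (h : 0 <= 0 :> R) : diag_monom h = 1.
Proof.
rewrite /diag_monom; suff -> : Expo (vle0_const n h) = expo0 by [].
by apply/val_inj/rowP => i; rewrite !mxE.
Qed.

Definition raises_degree (e : R) (M N : pmod) (f : M -> N) : Prop :=
  forall a x, comp a x -> comp (a + const_mx e) (f x).

(** A shift changes only the grading and not the underlying module, so both composites can be
    computed in [M] and [N] themselves. *)
Lemma interleavedP (e : R) (e0 : 0 <= e) (M N : pmod) :
  interleaved e0 M N <->
  exists (f : {linear M -> N}) (g : {linear N -> M}),
    [/\ raises_degree e f, raises_degree e g,
        forall x, g (f x) = diag_monom (double_ge0 e0) *: x &
        forall y, f (g y) = diag_monom (double_ge0 e0) *: y].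
Proof.
split.
  move=> [f [g [gf fg]]]; exists (hom_fun f), (hom_fun g); split=> //.
  - by move=> a x; exact: (hom_comp f).
  - by move=> a x; exact: (hom_comp g).
move=> [f [g [df dg gf fg]]].
by exists (@Hom k R n M (shift N (const_mx e)) f df),
          (@Hom k R n N (shift M (const_mx e)) g dg).
Qed.

Lemma interleaved_sym (e : R) (e0 : 0 <= e) (M N : pmod) :
  interleaved e0 M N -> interleaved e0 N M.
Proof. by move=> [f [g [gf fg]]]; exists g, f. Qed.

Lemma interleaved_iso (h : 0 <= 0 :> R) (M N : pmod) :
  iso M N -> interleaved h M N.
Proof.
have z : const_mx 0 = 0 :> vec by apply/rowP => i; rewrite !mxE.
have d : diag_monom (double_ge0 h) = 1.
  by rewrite (diag_monomD h h) ?diag_monom0 ?mulr1 // mulr0 addr0.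
move=> [f [g [fK gK]]]; apply/interleavedP; exists (hom_fun f), (hom_fun g).
split.
- by move=> a x hx; rewrite z addr0; exact: hom_comp.
- by move=> a x hx; rewrite z addr0; exact: hom_comp.
- by move=> x; rewrite fK d scale1r.
- by move=> x; rewrite gK d scale1r.
Qed.

(** The inner pair of maps composes to a monomial; linearity moves it past the outer pair, where it
    multiplies the second monomial. *)
Lemma interleaved_trans (e1 e2 : R) (h1 : 0 <= e1) (h2 : 0 <= e2)
    (h : 0 <= e1 + e2) (M N P : pmod) :
  interleaved h1 M N -> interleaved h2 N P -> interleaved h M P.
Proof.
move=> /interleavedP[f1 [g1 [df1 dg1 gf1 fg1]]].
move=> /interleavedP[f2 [g2 [df2 dg2 gf2 fg2]]].
have cD (x y : R) : const_mx (x + y) = const_mx x + const_mx y :> vec.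
  by apply/rowP => i; rewrite !mxE.
apply/interleavedP.
exists (f2 \o f1 : {linear M -> P}), (g1 \o g2 : {linear P -> M}); split.
- by move=> a x hx; rewrite cD addrA; exact/df2/df1.
- by move=> a x hx; rewrite [e1 + _]addrC cD addrA; exact/dg1/dg2.
- move=> x; rewrite /= gf2 linearZ /= gf1; apply: scale_scale.
  by apply: diag_monomD; rewrite addrC mulrDr.
- move=> x; rewrite /= fg1 linearZ /= fg2; apply: scale_scale.
  by apply: diag_monomD; rewrite mulrDr.
Qed.

(** * Formal properties of the interleaving distance *)

Lemma dI_ge0 (M N : pmod) : (0 <= dI M N)%E.
Proof. by apply: le_ereal_inf_tmp => _ [e [e0 [_ ->]]]; rewrite lee_fin. Qed.

Lemma dI_le (e : R) (e0 : 0 <= e) (M N : pmod) :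
  interleaved e0 M N -> (dI M N <= e%:E)%E.
Proof. by move=> h; apply: ereal_inf_lbound; exists e, e0. Qed.

Lemma dI_iso (M N : pmod) : iso M N -> dI M N = 0%E.
Proof.
move=> h; apply/eqP; rewrite eq_le dI_ge0 andbT.
exact: (dI_le (interleaved_iso (lexx 0) h)).
Qed.

Lemma dI_sym (M N : pmod) : dI M N = dI N M.
Proof.
congr ereal_inf; apply/seteqP.
by split=> _ [e [e0 [h ->]]]; exists e, e0; split=> //; exact: interleaved_sym.
Qed.

Lemma dI_approx (M N : pmod) (r : R) : (dI M N < r%:E)%E ->
  exists (e : R) (e0 : 0 <= e), e < r /\ interleaved e0 M N.
Proof.
move=> /ereal_inf_lt[_ [e [e0 [h ->]]]]; rewrite lte_fin => er.
by exists e, e0.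
Qed.

Lemma dI_triangle (M N P : pmod) : (dI M P <= dI M N + dI N P)%E.
Proof.
have := dI_ge0 M N; have := dI_ge0 N P.
case E1: (dI M N) => [r1| |] //; case E2: (dI N P) => [r2| |] // _ _;
  rewrite ?leey //.
(* Both distances are finite here. The infima need not be attained, so a slack [d] is shared equally
   between the two interleavings. *)
apply/lee_addgt0Pr => d d0.
have [e1 [h1 [l1 i1]]] : exists (e : R) (e0 : 0 <= e),
    e < r1 + d / 2 /\ interleaved e0 M N.
  by apply: dI_approx; rewrite E1 lte_fin; lra.
have [e2 [h2 [l2 i2]]] : exists (e : R) (e0 : 0 <= e),
    e < r2 + d / 2 /\ interleaved e0 N P.
  by apply: dI_approx; rewrite E2 lte_fin; lra.
apply: le_trans (dI_le (interleaved_trans (addr_ge0 h1 h2) i1 i2)) _.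
by rewrite -!EFinD lee_fin; lra.
Qed.

(** Isomorphic modules are at distance 0, so two triangle inequalities give each direction. *)
Lemma dI_iso_invariant (M M' N N' : pmod) :
  iso M M' -> iso N N' -> dI M N = dI M' N'.
Proof.
have le (A A' C C' : pmod) : iso A A' -> iso C C' -> (dI A C <= dI A' C')%E.
  move=> /dI_iso hA /iso_sym/dI_iso hC.
  apply: le_trans (dI_triangle _ A' _) _; rewrite hA add0e.
  by apply: le_trans (dI_triangle _ C' _) _; rewrite hC adde0.
by move=> hM hN; apply/eqP; rewrite eq_le !le //; exact: iso_sym.
Qed.

(* These are injectivity and surjectivity of the transition map
   [M_z -> M_(z + e)]. *)
Definition cancellable_at (M : pmod) (z : vec) (e : R) (e0 : 0 <= e) : Prop :=
  forall x : M, comp z x -> diag_monom e0 *: x = 0 -> x = 0.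

Definition divisible_at (M : pmod) (z : vec) (e : R) (e0 : 0 <= e) : Prop :=
  forall x : M, comp (z + const_mx e) x ->
    exists2 y, comp z y & diag_monom e0 *: y = x.

(** * Homogeneous multiplication and division in the monoid ring *)

Lemma mcoeff_monomM (r s : expo R n) (p : malg (expo R n) k) :
  mcoeff (expoD r s) (monom k r * p) = mcoeff s p.
Proof.
have addI : injective (expoD r).
  by move=> u v /(congr1 (@expo_val R n)) /= /addrI h; exact/val_inj.
rewrite [in LHS](monalgE p) mulr_sumr [in RHS](monalgE p).
rewrite (big_morph _ (mcoeffD (expoD r s)) (mcoeff0 _)).
rewrite (big_morph _ (mcoeffD s) (mcoeff0 _)); apply: eq_bigr => u _.
by rewrite -mkmalgUM mul1r !mcoeffU (inj_eq addI).
Qed.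

Lemma monomM_inj (r : expo R n) : injective ( *%R (monom k r)).
Proof.
by move=> p q h; apply: malg_ext => s; rewrite -(mcoeff_monomM r) h mcoeff_monomM.
Qed.

Lemma BcompM (a b : vec) (p q : B) :
  Bcomp a p -> Bcomp b q -> Bcomp (a + b) (p * q).
Proof.
move=> hp hq r; rewrite mcoeff_neq0 => /msuppM_le[u [v [hu hv ->]]].
by rewrite /= hp ?hq // mcoeff_neq0.
Qed.

Lemma Bproj0 (a : vec) : Bproj a 0 = 0 :> B.
Proof. by apply: malg_ext => r; rewrite BprojE mcoeff0 if_same. Qed.

(** Splitting [p] into components reduces this to degrees: [c + b = a + b] exactly when [c = a]. *)
Lemma BprojM (a b : vec) (p q : B) :
  Bcomp b q -> Bproj (a + b) (p * q) = Bproj a p * q.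
Proof.
move=> hq; pose s := undup [seq expo_val r | r <- msupp (p : malg (expo R n) k)].
have -> : p = \sum_(c <- s) Bproj c p.
  by apply: Bproj_sum => [|c]; rewrite ?undup_uniq ?mem_undup.
rewrite mulr_suml (big_morph _ (BprojD (a + b)) (Bproj0 _)).
rewrite (big_morph _ (BprojD a) (Bproj0 _)) mulr_suml.
apply: eq_bigr => c _; rewrite (Bproj_id _ (BcompM (@Bproj_comp _ _ _ c p) hq)).
rewrite (Bproj_id _ (@Bproj_comp _ _ _ c p)) (inj_eq (addIr b)).
by case: ifP; rewrite ?mul0r.
Qed.

(** Each component of [B] is at most a line. If [a >= 0], then [p] is a scalar times a monomial that
    the diagonal one divides; otherwise the second hypothesis makes the component of degree
    [a + const_mx e] vanish, and [p = 0]. *)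
Lemma Bcomp_divide (a : vec) (e : R) (e0 : 0 <= e) (p : B) :
  Bcomp (a + const_mx e) p -> (vle 0 (a + const_mx e) -> vle 0 a) ->
  exists2 q : B, Bcomp a q & diag_monom e0 * q = p.
Proof.
move=> hp hle; have [a0|na0] := boolP (vle 0 a).
  pose u := Expo a0; pose d := Expo (vle0_const n e0).
  pose c := mcoeff (expoD d u) (p : malg (expo R n) k).
  exists (mkmalgU u c).
    by move=> r; rewrite mcoeffU; case: (u =P r) => [<-//|_]; rewrite mulr0n eqxx.
  rewrite /diag_monom -mkmalgUM mul1r; apply: malg_ext => r; rewrite mcoeffU.
  case: eqP => [<-|nr]; first by rewrite mulr1n.
  rewrite mulr0n; apply/esym/eqP/negPn/negP => /hp hr; case: nr.
  by apply/val_inj; rewrite /= hr addrC.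
exists 0; first by move=> r; rewrite mcoeff0 eqxx.
rewrite mulr0; apply: malg_ext => r; rewrite mcoeff0; apply/esym/eqP/negPn/negP.
by move=> /hp hr; move: na0; rewrite hle // -hr expo_ge0.
Qed.

Lemma graded_scale_Bcomp (M : pmod) (a b : vec) (p : B) (x : M) :
  Bcomp b p -> comp a x -> comp (a + b) (p *: x).
Proof.
move=> hp hx; have gM := pmod_graded M.
rewrite (monalgE (p : malg (expo R n) k)) scaler_suml big_seq.
apply: (big_ind (@comp _ _ _ M (a + b))).
- exact: graded_0.
- by move=> u v; exact: graded_add.
move=> r; rewrite -mcoeff_neq0 => /hp <-.
by rewrite cst_monom -scalerA; apply/(graded_scale gM)/(graded_monom gM).
Qed.

Lemma vle_subl (a b c : vec) : vle 0 (a - b + c) = vle b (a + c).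
Proof.
by apply/vleP/vleP => h i; have := h i; rewrite !mxE addrAC subr_ge0.
Qed.

Lemma vle_sub0 (a b : vec) : vle 0 (a - b) = vle b a.
Proof. by rewrite -[a - b]addr0 vle_subl addr0. Qed.

(** * Transition maps of a presented module *)

Section Presented.
Context (G : finType) (gr : G -> vec).

Lemma free_scaleE (b : B) (p : free k gr) (y : G) : (b *: p) y = b * (p y : B).
Proof. by rewrite ffunE. Qed.

Lemma free_scale_inj (m : B) :
  injective ( *%R m) -> injective (fun p : free k gr => m *: p).
Proof.
move=> mI p q /ffunP h; apply/ffunP => y; apply: mI.
exact: etrans (esym (free_scaleE m p y)) (etrans (h y) (free_scaleE m q y)).
Qed.

(** The degree [a - c] does not depend on [y]: one component of [b] serves all coordinates of
    [b *: r] at once. *)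
Lemma free_projZ (a c : vec) (b : B) (r : free k gr) (y : G) : comp c r ->
  Bproj (a - gr y) ((b *: r) y) = (Bproj (a - c) b *: r) y.
Proof.
move=> hr; have := BprojM (a - c) b (hr y); rewrite addrA subrK => E.
refine (etrans (congr1 _ (free_scaleE b r y)) _).
exact: etrans E (esym (free_scaleE _ r y)).
Qed.

Lemma free_divide (a : vec) (e : R) (e0 : 0 <= e) (p : free k gr) :
  comp (a + const_mx e) p ->
  (forall y, vle (gr y) (a + const_mx e) -> vle (gr y) a) ->
  exists2 q : free k gr, comp a q & diag_monom e0 *: q = p.
Proof.
move=> hp hle.
have /choice[q hq] : forall y : G, exists q : B,
    Bcomp (a - gr y) q /\ diag_monom e0 * q = p y.
  move=> y; have [| |q hq E] := @Bcomp_divide (a - gr y) e e0 (p y).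
  - by have := hp y; rewrite addrAC.
  - by rewrite vle_subl vle_sub0; exact: hle.
  - by exists q.
exists ([ffun y => q y : B^o] : {ffun G -> B^o}).
  by move=> y; rewrite ffunE; case: (hq y).
by apply/ffunP => y; rewrite !ffunE; case: (hq y).
Qed.

Context (rs : seq (free k gr)) (hrs : forall r, r \in rs -> homogeneous r).
Context (w : free k gr -> vec) (hw : forall r, r \in rs -> comp (w r) r).
Local Notation P := (pquot hrs).
Local Notation pi := (@quotmod_pi _ (free k gr) rs).

(** Projecting any expression of [p] to degree [a] fixes [p] and replaces each coefficient by its
    component of the complementary degree. *)
Lemma gen_submod_homogeneous (a : vec) (p : free k gr) :
  comp a p -> p \in gen_submod rs ->
  exists b : 'I_(size rs) -> B,
    (forall i : 'I_(size rs), Bcomp (a - w rs`_i) (b i)) /\ p = \sum_i b i *: rs`_i.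
Proof.
move=> hp /asboolP[b pE]; exists (fun i : 'I_(size rs) => Bproj (a - w rs`_i) (b i)).
split=> [i|]; first exact: Bproj_comp.
apply/ffunP => y; rewrite sum_ffunE.
have -> : p y = Bproj (a - gr y) (p y) by rewrite (Bproj_id _ (hp y)) eqxx.
rewrite {1}pE sum_ffunE (big_morph _ (BprojD _) (Bproj0 _)).
by apply: eq_bigr => i _; apply: free_projZ; apply/hw/mem_nth.
Qed.

(** If [x^e p] is a combination of relations, its coefficients can be taken homogeneous. A nonzero
    one belongs to a relation of grade at most [z + e], hence at most [z], so it is divisible by
    [x^e]. Cancelling [x^e] in the free module expresses [p] through the relations. *)
Lemma pquot_cancellable (z : vec) (e : R) (e0 : 0 <= e) :
  (forall r, r \in rs -> vle (w r) (z + const_mx e) -> vle (w r) z) ->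
  cancellable_at P z e0.
Proof.
move=> hle _ [p [hp ->]]; rewrite -linearZ => /quotmod_pi_eq0 hS.
have hmp : comp (z + const_mx e) (diag_monom e0 *: p).
  exact: (graded_monom (pmod_graded (free k gr)) (Expo (vle0_const n e0)) hp).
have [b [hb E]] := gen_submod_homogeneous hmp hS.
have /choice[c hc] : forall i : 'I_(size rs), exists c : B,
    diag_monom e0 * c = b i.
  move=> i; have [| |c _ cE] := @Bcomp_divide (z - w rs`_i) e e0 (b i).
  - by have := hb i; rewrite addrAC.
  - by rewrite vle_subl vle_sub0; apply: hle; exact: mem_nth.
  - by exists c.
apply/quotmod_pi_eq0/asboolP; exists c.
apply: (free_scale_inj (@monomM_inj (Expo (vle0_const n e0)))).
by rewrite /= -(scale_sumr _ (fun i => esym (hc i))).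
Qed.

(** No generator appears between [z] and [z + e], so a representative can be divided in the free
    module. *)
Lemma pquot_divisible (z : vec) (e : R) (e0 : 0 <= e) :
  (forall y, vle (gr y) (z + const_mx e) -> vle (gr y) z) ->
  divisible_at P z e0.
Proof.
move=> hle _ [p [hp ->]]; have [q hq <-] := free_divide e0 hp hle.
by exists (pi q); [exists q|rewrite linearZ].
Qed.

Definition free_gen (y : G) : free k gr :=
  [ffun y' => (y' == y)%:R : B^o] : {ffun G -> B^o}.

Lemma free_gen_comp y : comp (gr y) (free_gen y).
Proof.
move=> y'; rewrite ffunE; case: eqP => [->|_].
  move=> r; by rewrite subrr mcoeff1; case: (r =P mone) => [->|_]; rewrite ?eqxx.
by move=> r; rewrite mcoeff0 eqxx.
Qed.

Lemma free_genE (p : free k gr) : p = \sum_y (p y : B) *: free_gen y.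
Proof.
apply/ffunP => y; rewrite sum_ffunE.
have E z : ((p z : B) *: free_gen z) y = (p z : B) * (y == z)%:R.
  by refine (etrans (free_scaleE _ _ _) _); rewrite ffunE.
rewrite (eq_bigr _ (fun z _ => E z)) (bigD1 y) //= eqxx mulr1 big1 ?addr0 //.
by move=> z; rewrite eq_sym => /negPf ->; exact: mulr0.
Qed.

Lemma pquot_linear_id (h : {linear P -> P}) :
  (forall y, h (pi (free_gen y)) = pi (free_gen y)) -> forall x, h x = x.
Proof.
move=> hh x; rewrite -[x]quotmod_piK [repr _]free_genE.
rewrite !linear_sum; apply: eq_bigr => y _.
by rewrite !linearZ /= hh.
Qed.

(** * Morphisms out of a presented module *)

Section Lift.
Context (N : pmod) (v : G -> N) (hv : forall y, comp (gr y) (v y)).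

Definition free_lift (p : free k gr) : N := \sum_y (p y : B) *: v y.

Lemma free_lift_is_linear : linear free_lift.
Proof.
move=> a x y; rewrite scaler_sumr -big_split /=; apply: eq_bigr => z _.
by rewrite !ffunE scalerDl scalerA.
Qed.
HB.instance Definition _ :=
  GRing.isLinear.Build B (free k gr) N *:%R free_lift free_lift_is_linear.

Lemma free_lift_comp a p : comp a p -> comp a (free_lift p).
Proof.
move=> hp; apply: (big_ind (@comp _ _ _ N a)) => [|x y|y _].
- exact: (graded_0 (pmod_graded N)).
- exact: (graded_add (pmod_graded N)).
- have -> : a = gr y + (a - gr y) by rewrite addrC subrK.
  exact: graded_scale_Bcomp (hp y) (hv y).
Qed.

Hypothesis kills : forall r, r \in rs -> free_lift r = 0.

Lemma free_lift_gen_submod p : p \in gen_submod rs -> free_lift p = 0.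
Proof.
move=> /asboolP[b ->]; rewrite linear_sum big1 // => i _.
by rewrite linearZ /= kills ?scaler0 // mem_nth.
Qed.

(** The value is read off a chosen representative; [pquot_lift_pi] shows that the choice does not
    matter. *)
Definition pquot_lift (q : P) : N := free_lift (repr (q : quotmod rs)).

Lemma pquot_lift_pi p : pquot_lift (pi p) = free_lift p.
Proof.
apply/eqP; rewrite -subr_eq0 -linearB; apply/eqP/free_lift_gen_submod.
by apply/quotmod_piP; rewrite quotmod_piK.
Qed.

Lemma pquot_lift_is_linear : linear pquot_lift.
Proof.
move=> a x y; rewrite -[x]quotmod_piK -[y]quotmod_piK -linearP !pquot_lift_pi.
exact: linearP.
Qed.
HB.instance Definition _ :=
  GRing.isLinear.Build B P N *:%R pquot_lift pquot_lift_is_linear.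

Lemma pquot_lift_comp a x :
  comp a x -> comp a ((pquot_lift : {linear P -> N}) x).
Proof. by move=> [p [hp ->]]; rewrite /= pquot_lift_pi; exact: free_lift_comp. Qed.

Definition pquot_lift_hom : hom P N := Hom pquot_lift_comp.

End Lift.

Lemma free_lift_linear (N : pmod) (h : {linear free k gr -> N}) p :
  h p = free_lift (fun y => h (free_gen y)) p.
Proof.
rewrite {1}(free_genE p) linear_sum; apply: eq_bigr => y _.
exact: linearZ.
Qed.

Lemma free_lift_scale (N : pmod) (m : B) (v v' : G -> N) p :
  (forall y, m *: v y = v' y) -> m *: free_lift v p = free_lift v' p.
Proof.
move=> h; rewrite scaler_sumr; apply: eq_bigr => y _; rewrite -h.
by rewrite !scalerA [m * _]mulrC.
Qed.

(** Divisibility at the grades of the generators gives their images under [f']; cancellability at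
    the grades of the relations makes these images respect the relations. *)
Lemma pquot_divide_linear (N : pmod) (e : R) (e0 : 0 <= e)
    (f : {linear P -> N}) :
  raises_degree e f ->
  (forall y, divisible_at N (gr y) e0) ->
  (forall r, r \in rs -> cancellable_at N (w r) e0) ->
  exists f' : hom P N, forall x, diag_monom e0 *: f' x = f x.
Proof.
move=> df dN cN.
have /choice[v hv] : forall y, exists v : N,
    comp (gr y) v /\ diag_monom e0 *: v = f (pi (free_gen y)).
  move=> y; have [|v hv E] := dN y (f (pi (free_gen y))); last by exists v.
  by apply: df; exists (free_gen y); split=> //; exact: free_gen_comp.
have hv1 y : comp (gr y) (v y) by case: (hv y).
have E p : diag_monom e0 *: free_lift v p = f (pi p).
  apply: etrans (esym (free_lift_linear (f \o pi : {linear free k gr -> N}) p)).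
  by apply: free_lift_scale => y; case: (hv y).
(* [x^e] times the image of a relation is [f] of its class, which is 0; the image has degree [w r],
   where [x^e] can be cancelled. *)
have kills r : r \in rs -> free_lift v r = 0.
  move=> hr; apply: (cN r hr); first exact/(free_lift_comp hv1)/hw.
  rewrite E (_ : pi r = 0) ?linear0 //; apply/quotmod_pi_eq0/asboolP.
  have ri : (index r rs < size rs)%N by rewrite index_mem.
  exists (fun i => (i == Ordinal ri)%:R).
  rewrite (bigD1 (Ordinal ri)) //= eqxx scale1r nth_index // big1 ?addr0 //.
  by move=> i /negPf ->; rewrite scale0r.
exists (pquot_lift_hom hv1 kills) => x.
rewrite -[x]quotmod_piK.
exact: etrans (congr1 _ (pquot_lift_pi kills _)) (E _).
Qed.

(** On the class of a generator [y], the difference between [h2 \o h1] and the identity is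
    homogeneous of degree [gr y] and killed by the monomial, hence 0. *)
Lemma pquot_retraction (N : pmod) (e : R) (e0 : 0 <= e)
    (h1 : hom P N) (h2 : hom N P) :
  (forall y, cancellable_at P (gr y) e0) ->
  (forall x, diag_monom e0 *: h2 (h1 x) = diag_monom e0 *: x) ->
  cancel h1 h2.
Proof.
move=> cP E; apply: (pquot_linear_id (h := h2 \o h1 : {linear P -> P})) => y.
have hy : comp (gr y) (pi (free_gen y) : P).
  by exists (free_gen y); split=> //; exact: free_gen_comp.
apply/eqP; rewrite -subr_eq0; apply/eqP/(cP y).
  have gP := pmod_graded P.
  by apply: (graded_add gP); [exact/hom_comp/hom_comp|exact: (graded_opp gP)].
by rewrite scalerBr; apply/eqP; rewrite subr_eq0; apply/eqP/E.
Qed.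

End Presented.

(** * Gaps between grades, and separation *)

Lemma exists_gap (s : seq R) :
  exists2 g : R, 0 < g & forall x, x \in s -> 0 < x -> g <= x.
Proof.
elim: s => [|y s [g g0 hg]]; first by exists 1.
have [y0|y0] := ltP 0 y; last first.
  exists g => // x; rewrite inE => /orP[/eqP->|]; last exact: hg.
  by rewrite ltNge y0.
exists (Num.min g y); first by rewrite lt_min g0.
move=> x; rewrite inE => /orP[/eqP-> _|xs x0]; rewrite ge_min ?lexx ?orbT //.
by rewrite hg.
Qed.

(** Take [g] below all positive coordinate differences within [V]. If [a] exceeds [b] in some
    coordinate, it does so by at least [g > e], against [a <= b + e]. *)
Lemma vle_gap (V : seq vec) :
  exists2 g : R, 0 < g & forall e, e < g -> forall a b : vec,
    a \in V -> b \in V -> vle a (b + const_mx e) -> vle a b.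
Proof.
pose d (c : vec * vec * 'I_n) := c.1.1 0 c.2 - c.1.2 0 c.2.
have [g g0 hg] :=
  exists_gap (map d (allpairs pair (allpairs pair V V) (enum 'I_n))).
exists g => // e eg a b aV bV /vleP h; apply/vleP => i.
rewrite leNgt; apply/negP => hi; have := h i; rewrite !mxE leNgt => /negP; apply.
rewrite -ltrBrDl (lt_le_trans eg) // hg ?subr_gt0 //.
by apply: (map_f d (x := (a, b, i))); rewrite !allpairs_f ?mem_enum.
Qed.

(** A zero relation is homogeneous of every degree, so the grades of relations are chosen; outside
    [rs] the value is arbitrary. *)
Lemma homogeneous_degree (M : pmod) (rs : seq M) :
  (forall r, r \in rs -> homogeneous r) ->
  exists w : M -> vec, forall r, r \in rs -> comp (w r) r.
Proof.
move=> hrs; have /choice[w hw] : forall r : M, exists a, r \in rs -> comp a r.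
  by move=> r; have [/hrs[a ha]|_] := boolP (r \in rs); [exists a|exists 0].
by exists w.
Qed.

Lemma pquot_iso_of_dI0 (G H : finType) (gG : G -> vec) (gH : H -> vec)
    (rG : seq (free k gG)) (rH : seq (free k gH))
    (hG : forall r, r \in rG -> homogeneous r)
    (hH : forall r, r \in rH -> homogeneous r) :
  dI (pquot hG) (pquot hH) = 0%E -> iso (pquot hG) (pquot hH).
Proof.
move=> d0; have [wG hwG] := homogeneous_degree hG.
have [wH hwH] := homogeneous_degree hH.
pose V := (map gG (enum G) ++ map wG rG) ++ (map gH (enum H) ++ map wH rH).
have VG y : gG y \in V by rewrite !mem_cat map_f ?mem_enum.
have VH y : gH y \in V by rewrite !mem_cat map_f ?orbT ?mem_enum.
have VrG r : r \in rG -> wG r \in V by move=> hr; rewrite !mem_cat map_f ?orbT.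
have VrH r : r \in rH -> wH r \in V by move=> hr; rewrite !mem_cat map_f ?orbT.
have [g g0 hg] := vle_gap V.
(* Half the gap is required: dividing [f1] and [f2] uses [e < g], while cancelling the square of the
   monomial uses [2 * e < g]. *)
have [e [e0 [eg /interleavedP[f1 [f2 [df1 df2 f21 f12]]]]]] :
    exists (e : R) (e0 : 0 <= e),
      e < g / 2 /\ interleaved e0 (pquot hG) (pquot hH).
  by apply: dI_approx; rewrite d0 lte_fin; lra.
have ltg : e < g by lra.
have lt2g : 2 * e < g by lra.
have [h1 E1] : exists h : hom (pquot hG) (pquot hH),
    forall x, diag_monom e0 *: h x = f1 x.
  apply: (pquot_divide_linear hwG df1) => [y|r hr].
    by apply: pquot_divisible => z; apply: hg.
  by apply: (pquot_cancellable hwH) => z hz; apply: hg; auto.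
have [h2 E2] : exists h : hom (pquot hH) (pquot hG),
    forall x, diag_monom e0 *: h x = f2 x.
  apply: (pquot_divide_linear hwH df2) => [y|r hr].
    by apply: pquot_divisible => z; apply: hg.
  by apply: (pquot_cancellable hwG) => z hz; apply: hg; auto.
have dd : diag_monom (double_ge0 e0) = diag_monom e0 * diag_monom e0.
  by apply: diag_monomD; rewrite mulr2n mulrDl mul1r.
exists h1, h2; split.
  apply: (pquot_retraction (e0 := double_ge0 e0)) => [y|x].
    by apply: (pquot_cancellable hwG) => r hr; apply: hg; auto.
  exact: etrans (scale_composite dd E1 E2 x) (f21 x).
apply: (pquot_retraction (e0 := double_ge0 e0)) => [y|x].
  by apply: (pquot_cancellable hwH) => r hr; apply: hg; auto.
exact: etrans (scale_composite dd E2 E1 x) (f12 x).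
Qed.

Lemma dI0_iso (M N : fpmodule k R n) : dI M N = 0%E -> iso M N.
Proof.
case: M N => M [G [gG [rG [hG iM]]]] [N [H [gH [rH [hH iN]]]]] /=.
rewrite (dI_iso_invariant iM iN) => /pquot_iso_of_dI0 h.
exact: iso_trans iM (iso_trans h (iso_sym iN)).
Qed.

End Interleaving.

(** * The metric on isomorphism classes *)

Theorem corollary2p5p2 (k : fieldType) (R : realType) (n : nat)
    (n_ge1 : (1 <= n)%N) :
  exists d : iso_class k R n -> iso_class k R n -> \bar R,
    (forall M N : fpmodule k R n, d (class_of M) (class_of N) = dI M N) /\
    is_metric d.
Proof.
have [rep hrep] := choice (@class_of_surj k R n).
(* The distance is evaluated on chosen representatives; invariance under isomorphism makes it agree
   with [dI] on all others. *)
exists (fun C D => dI (rep C) (rep D)); split=> [M N|].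
  by apply: dI_iso_invariant; apply/class_of_eq.
split=> [C D|C|C D|C D E|C D CD d0].
- exact: dI_ge0.
- exact/dI_iso/iso_refl.
- exact: dI_sym.
- exact: dI_triangle.
- by apply: CD; rewrite (hrep C) (hrep D); apply/class_of_eq/dI0_iso.
Qed.
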